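(* Let $K$ be any field, let $d\ge 2$ be an even integer and $m=d-1=2p+1$. For $1\le r\le m$ let $S_r$ be the $(p+1)\times(p+1)$ matrix over $K$ with $S_r(j,k)=1$ if $k-j=p+1-r$ and $S_r(j,k)=0$ otherwise, and let $S_r\oplus S_r$ be the $d\times d$ block diagonal matrix with two diagonal blocks equal to $S_r$. Then the tensor $$T=\sum_{i=1}^me_i\otimes(S_i\oplus S_i)\in K^d\otimes K^d\otimes K^d$$ has border rank $\ge 2d-2$.
   Context: Here $e_1,\dots,e_d$ is the standard basis of $K^d$ and $d\times d$ matrices are identified with elements of $K^d\otimes K^d$ via $E_{j,k}\leftrightarrow e_j\otimes e_k$. The tensor rank of a tensor is the smallest $n$ such that it is a sum of $n$ pure tensors; $Z_n$ is the set of tensors of tensor rank $\le n$, $\overline Z_n$ its Zariski closure (in the affine space $K^d\otimes K^d\otimes K^d$ over $K$); the border rank of $T$ is the smallest $n$ with $T\in\overline Z_n$. *)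

(* Defs.v *)
From mathcomp Require Import all_boot all_order all_algebra.
From mathcomp Require Import boolp.
From mathcomp Require Import mpoly.

Set Implicit Arguments.
Unset Strict Implicit.
Unset Printing Implicit Defensive.

Import GRing.Theory.
Local Open Scope ring_scope.

(* Affine spaces are coordinate spaces {ffun I -> K} over a finite index type;
   their coordinate rings are polynomial rings in #|I| variables, the variable
   'X_i standing for the coordinate enum_val i. *)
Definition eval_at (K : fieldType) (I : finType)
    (f : {mpoly K[#|I|]}) (x : {ffun I -> K}) : K :=
  f.@[fun i => x (enum_val i)].

Definition zariski_closure (K : fieldType) (I : finType)
    (Z : {ffun I -> K} -> Prop) (x : {ffun I -> K}) : Prop :=
  forall f : {mpoly K[#|I|]}, (forall z, Z z -> eval_at f z = 0) ->
    eval_at f x = 0.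

(* K^d (x) K^d (x) K^d, where T (i, j, k) is the coefficient of
   e_i (x) e_j (x) e_k. *)
Notation tensor K d := {ffun 'I_d * 'I_d * 'I_d -> K}.

(* u (x) A, the matrix A being read as the sum of the A j k *: e_j (x) e_k. *)
Definition tens_vec_mx (K : fieldType) (d : nat)
    (u : 'rV[K]_d) (A : 'M[K]_d) : tensor K d :=
  [ffun x => u 0 x.1.1 * A x.1.2 x.2].

Definition pure_tensor (K : fieldType) (d : nat) (u v w : 'rV[K]_d) :
    tensor K d :=
  [ffun x => u 0 x.1.1 * v 0 x.1.2 * w 0 x.2].

Definition sum_of_pure (K : fieldType) (d : nat) (T : tensor K d) (n : nat) :
    Prop :=
  exists u v w : 'I_n -> 'rV[K]_d,
    T = \sum_(i < n) pure_tensor (u i) (v i) (w i).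

Lemma sum_of_pure_exists (K : fieldType) (d : nat) (T : tensor K d) :
  exists n, `[< sum_of_pure T n >].
Proof.
exists #|{: 'I_d * 'I_d * 'I_d}|; apply/asboolP.
exists (fun i => T (enum_val i) *: delta_mx 0 (enum_val i).1.1),
  (fun i => delta_mx 0 (enum_val i).1.2), (fun i => delta_mx 0 (enum_val i).2).
apply/ffunP => -[[a b] c]; rewrite sum_ffunE.
rewrite (bigD1 (enum_rank (a, b, c))) //= big1 => [|i ne_i].
  by rewrite ffunE enum_rankK !mxE !eqxx /= !mulr1 addr0.
rewrite ffunE !mxE /=; have : enum_val i != (a, b, c).
  by apply: contra ne_i => /eqP <-; rewrite enum_valK.
case: (enum_val i) => [[a' b'] c'] /=.
rewrite !xpair_eqE (eq_sym a) (eq_sym b) (eq_sym c).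
by case: (a' == a); case: (b' == b); case: (c' == c) => //= _;
  rewrite ?(mulr0, mul0r).
Qed.

Definition tensor_rank (K : fieldType) (d : nat) (T : tensor K d) : nat :=
  ex_minn (sum_of_pure_exists T).

Definition rank_le (K : fieldType) (d n : nat) (T : tensor K d) : Prop :=
  (tensor_rank T <= n)%N.

Lemma border_rank_exists (K : fieldType) (d : nat) (T : tensor K d) :
  exists n, `[< zariski_closure (@rank_le K d n) T >].
Proof.
by exists (tensor_rank T); apply/asboolP => f; apply; rewrite /rank_le.
Qed.

Definition border_rank (K : fieldType) (d : nat) (T : tensor K d) : nat :=
  ex_minn (border_rank_exists T).

(* The index r keeps its range 1, ..., 2p + 1. Row and column indices start
   at 0 instead of 1, which leaves k - j unchanged. *)
Definition shift_mx (K : fieldType) (p r : nat) : 'M[K]_p.+1 :=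
  \matrix_(j, k) (k%:Z - j%:Z == p.+1%:Z - r%:Z)%:R.

Lemma double_dim (d m p : nat) : (2 <= d)%N -> m = d.-1 -> m = p.*2.+1 ->
  (p.+1 + p.+1 = d)%N.
Proof. by case: d => [|d] //= _ -> ->; rewrite -addnn addnS addSn. Qed.

Definition shift_mx_dsum (K : fieldType) (d p r : nat)
    (dE : (p.+1 + p.+1 = d)%N) : 'M[K]_d :=
  castmx (dE, dE) (block_mx (shift_mx K p r) 0 0 (shift_mx K p r)).

(* Main.v *)
Require Import Defs.
From mathcomp Require Import all_boot all_order all_algebra all_fingroup.
From mathcomp Require Import boolp mpoly zify ring.

Set Implicit Arguments.
Unset Strict Implicit.
Unset Printing Implicit Defensive.

Import GRing.Theory.
Local Open Scope ring_scope.

(** The lower bound comes from a Koszul flattening.  Let V = K^m, with basis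
    e_0, ..., e_(m-1), be the span of the first m basis vectors of the first
    factor.  A tensor T, with coordinate matrices T_i, induces the linear map

      Lambda^p V (x) K^d -> Lambda^(p+1) V (x) K^d,
      omega (x) b |-> sum_i (e_i /\ omega) (x) b T_i,

    with b a row vector, whose matrix is [koszul_mx].  For a pure tensor
    u (x) v (x) w this is, up to the rank one factor v (x) w, the map
    omega |-> a /\ omega with a the projection of u to V.  It is 0 if a = 0, and
    otherwise factors through Lambda^p (V / a), of dimension 'C(m - 1, p).
    Minors are polynomials in T, hence
    rank (koszul_mx T) <= border_rank T * 'C(m - 1, p)  ([rank_koszul_border]).

    For the tensor of the theorem, m = 2 p + 1 and the map is injective
    ([row_free_koszul_shift]), so that
    d * 'C(2 p + 1, p) <= border_rank T * 'C(2 p, p), and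
    (p + 1) * 'C(2 p + 1, p) = (2 p + 1) * 'C(2 p, p) gives the bound
    2 (2 p + 1) = 2 d - 2.

    Injectivity holds over every field because it follows from an identity of
    polynomials.  It suffices to treat one of the two diagonal blocks.  An
    element of Lambda^p V (x) K^(p+1) is read as a polynomial
    P (x_1, ..., x_p; t), of degree < n := 2 p + 1 in each x_r and <= p in t.
    With E_x (t) = (x^n - t^n) / (x - t), the map takes P to the coefficients of
    t^p, ..., t^(2p) in

      Q = sum_s (-1)^s E_(x_s) (t) P (..., x_(s-1), x_(s+1), ...; t),
      where s ranges over 0, ..., p.

    If these vanish, then Q = B + t^n A with deg B < p.  Let Pi be the product
    of all x_s - t, and Phi_s that of P (..., x_(s-1), x_(s+1), ...; t) and the
    x_r - t for r <> s.  Multiplying by Pi gives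

      sum_s (-1)^s x_s^n Phi_s - Pi B = t^n (sum_s (-1)^s Phi_s + Pi A).

    The left side has degree < n in t, so both sides are 0; setting t = x_0 in
    sum_s (-1)^s Phi_s + Pi A = 0 leaves Phi_0 (x_0) = 0, that is
    P (x_1, ..., x_p; x_0) = 0 ([middle_coefs_inj]).  This holds for every
    polynomial P with these degrees, so that it is enough to embed Lambda^p V in
    the p-th tensor power of V ([koszul_middle_inj]), mapping e_t to its
    determinantal coordinates. *)

(** * Truncated products with a geometric polynomial *)

(** The quotient (x^n - X^n) / (x - X), see [geom_polyE]. *)
Definition geom_poly (R : comNzRingType) (n : nat) (x : R) : {poly R} :=
  \sum_(i < n) x ^+ (n.-1 - i) *: 'X^i.

Lemma geom_polyE (R : comNzRingType) (n : nat) (x : R) :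
  (x%:P - 'X) * geom_poly n x = (x ^+ n)%:P - 'X^n.
Proof.
rewrite polyC_exp subrXX; congr (_ * _).
by apply: eq_bigr => i _; rewrite -mul_polyC polyC_exp.
Qed.

Lemma coef_geom_poly (R : comNzRingType) (n : nat) (x : R) (i : nat) :
  (geom_poly n x)`_i = if (i < n)%N then x ^+ (n.-1 - i) else 0.
Proof.
by rewrite /geom_poly -(poly_def n (fun i => x ^+ (n.-1 - i))) coef_poly.
Qed.

Lemma eq0_of_size_mulXn (R : nzRingType) (n : nat) (f g : {poly R}) :
  (size f <= n)%N -> f = g * 'X^n -> g = 0.
Proof.
move=> szf fE; apply/polyP => i; rewrite coef0.
have := congr1 (fun h : {poly R} => h`_(i + n)) fE.
rewrite coefMXn ltnNge leq_addl /= addnK => <-.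
by rewrite nth_default // (leq_trans szf) ?leq_addl.
Qed.

Lemma size_prod_subX (R : idomainType) (I : finType) (P : pred I) (x : I -> R) :
  (size (\prod_(r | P r) ((x r)%:P - 'X))%R <= #|P|.+1)%N.
Proof.
apply: leq_trans (size_poly_prod_leq _ _) _.
rewrite leq_subLR addnS ltnS addnn -muln2.
have -> : (#|P| * 2 = \sum_(i | P i) 2)%N by rewrite sum_nat_const.
by apply: leq_sum => i _; rewrite -opprB size_polyN size_XsubC.
Qed.

(** The polynomial identity behind the injectivity of the flattening.  Once
    the middle coefficients of the alternating sum vanish, multiplying it by the
    product of the x_r - X turns each geometric polynomial into x_s^n - X^n, and
    comparing degrees separates the part divisible by X^n from the rest. *)
Lemma middle_coefs_inj (R : idomainType) (p : nat) (x : 'I_p.+1 -> R)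
    (P : 'I_p.+1 -> {poly R}) :
  injective x -> (forall s, size (P s) <= p.+1)%N ->
  (forall k, (k <= p)%N ->
     (\sum_(s < p.+1) (-1) ^+ s *: (geom_poly p.*2.+1 (x s) * P s))`_(p + k)
       = 0) ->
  forall s, (P s).[x s] = 0.
Proof.
move=> x_inj szP mid s0; set n := p.*2.+1 in mid *.
set Q := \sum_s _ in mid.
set Phi := fun s => (\prod_(r | r != s) ((x r)%:P - 'X)) * P s.
set Pi := \prod_r ((x r)%:P - 'X).
have PiE s : Pi = ((x s)%:P - 'X) * \prod_(r | r != s) ((x r)%:P - 'X).
  by rewrite /Pi (bigD1 s).
pose A := drop_poly n Q; pose B := take_poly p Q.
have QE : Q = B + A * 'X^n.
  apply/polyP => i; rewrite coefD coefMXn coef_take_poly coef_drop_poly.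
  case: (ltnP i p) => ip.
    by rewrite ifT ?addr0 // (leq_trans ip) // /n -addnn -addnS leq_addr.
  rewrite add0r; case: ltnP => [lt_in|le_ni]; last by rewrite subnK.
  by rewrite -(subnKC ip) mid // leq_subLR addnn -ltnS.
have szPhi s : (size (Phi s) <= n)%N.
  apply: leq_trans (size_polyMleq _ _) _.
  have := size_prod_subX (fun r => r != s) x; have := szP s.
  rewrite cardC1 card_ord => le1 le2.
  lia.
have szPi : (size Pi <= p.+2)%N.
  by apply: leq_trans (size_prod_subX _ _) _; rewrite card_ord.
pose Z := \sum_(s < p.+1) (-1) ^+ s *: Phi s + Pi * A.
(* Pi * Q computed in two ways, with the multiples of 'X^n on the right. *)
have key : \sum_(s < p.+1) ((-1) ^+ s * x s ^+ n) *: Phi s - Pi * B = Z * 'X^n.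
  apply/eqP; rewrite subr_eq mulrDl -addrA -mulrA -mulrDr (addrC _ B) -QE.
  rewrite mulr_sumr mulr_suml -big_split /=; apply/eqP/eq_bigr => s _.
  rewrite -scalerAr -scalerAl -scalerDr -scalerA; congr (_ *: _).
  have -> : Pi * (geom_poly n (x s) * P s) =
      (((x s)%:P - 'X) * geom_poly n (x s)) * Phi s.
    by rewrite (PiE s) /Phi; ring.
  by rewrite geom_polyE -mul_polyC; ring.
have Z0 : Z = 0.
  apply: (eq0_of_size_mulXn _ key); apply: leq_trans (size_polyD _ _) _.
  rewrite size_polyN geq_max; apply/andP; split.
    apply: (leq_trans (size_sum _ _ _)); apply/bigmax_leqP => s _.
    exact: leq_trans (size_scale_leq _ _) _.
  apply: leq_trans (size_polyMleq _ _) _.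
  have szB : (size B <= p)%N by exact: size_take_poly.
  by move: (size Pi) (size B) szPi szB => a b; rewrite /n; lia.
(* At x s0 every summand of Z except the one of index s0 vanishes. *)
have Zx : Z.[x s0] = 0 by rewrite Z0 horner0.
have factorE r : ((x r)%:P - 'X).[x s0] = x r - x s0.
  by rewrite hornerD hornerN hornerC hornerX.
have Phi0 s : s != s0 -> (Phi s).[x s0] = 0.
  move=> ne_s; rewrite hornerM (bigD1 s0) 1?eq_sym //= hornerM.
  by rewrite factorE subrr !mul0r.
have Pi0 : Pi.[x s0] = 0 by rewrite (PiE s0) hornerM factorE subrr mul0r.
move: Zx; rewrite /Z (bigD1 s0) //= !hornerD hornerZ horner_sum.
rewrite big1 => [|s ne_s].
  rewrite [(Pi * A).[_]]hornerM Pi0 mul0r !addr0 => /eqP.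
  rewrite mulf_eq0 signr_eq0 /= /Phi hornerM mulf_eq0 => /orP[|/eqP //].
  rewrite horner_prod prodf_seq_eq0 => /hasP[r _ /andP[ne_r]].
  by rewrite factorE subr_eq0 => /eqP/x_inj E; rewrite E eqxx in ne_r.
by rewrite hornerZ Phi0 ?mulr0.
Qed.

(** * Injectivity on functions of p-tuples of indices *)

Lemma sum_ffun_lift (V : nmodType) (n : nat) (T : finType) (s : 'I_n.+1)
    (F : {ffun 'I_n.+1 -> T} -> V) :
  \sum_g F g =
  \sum_i \sum_(h : {ffun 'I_n -> T}) F [ffun r => oapp h i (unlift s r)].
Proof.
rewrite pair_bigA /=.
pose glue (ih : T * {ffun 'I_n -> T}) : {ffun 'I_n.+1 -> T} :=
  [ffun r => oapp ih.2 ih.1 (unlift s r)].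
rewrite (reindex glue) //.
exists (fun g : {ffun 'I_n.+1 -> T} => (g s, [ffun r : 'I_n => g (lift s r)]))
  => [[i h] _ | g _].
  congr pair; first by rewrite ffunE unlift_none.
  by apply/ffunP => r; rewrite !ffunE liftK.
by apply/ffunP => r; rewrite ffunE; case: unliftP => [j|] -> /=; rewrite ?ffunE.
Qed.

(** Om j h is the coefficient of e_(h 0) (x) ... (x) e_(h (p-1)) (x) t^j in an
    element of the p-th tensor power of V, tensored with K[t].  The hypothesis is
    the vanishing of the coefficients of t^p, ..., t^(2p) in the alternating sum
    over the p + 1 positions s at which sum_i t^(2p-i) e_i is inserted.  Encoding
    e_i in position r as the i-th power of an indeterminate 'X_r reduces the
    claim to [middle_coefs_inj] over a ring of multivariate polynomials, where
    the points 'X_s are distinct; evaluating at t = 'X_0 loses nothing because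
    'X_0 is not among the indeterminates that encode h. *)
Lemma koszul_middle_inj (K : fieldType) (p : nat)
    (Om : 'I_p.+1 -> {ffun 'I_p -> 'I_p.*2.+1} -> K) :
  (forall (g : {ffun 'I_p.+1 -> 'I_p.*2.+1}) (k : 'I_p.+1),
     \sum_(s < p.+1) (-1) ^+ s *
       \sum_(j < p.+1) (g s + k == p + j)%N%:R * Om j [ffun r => g (lift s r)]
     = 0) ->
  forall j h, Om j h = 0.
Proof.
move=> Om0.
pose x (s : 'I_p.+1) : {mpoly K[p.+1]} := 'X_s.
pose mon s (h : {ffun 'I_p -> 'I_p.*2.+1}) := \prod_r x (lift s r) ^+ h r.
pose c s j := \sum_h Om j h *: mon s h.
pose P s := \sum_(j < p.+1) c s j *: 'X^j.
have x_inj : injective x.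
  move=> s t /(congr1 (fun f => f@_U_(s))); rewrite !mcoeffXU eqxx.
  by case: eqP => // _ /eqP; rewrite oner_eq0.
have szP s : (size (P s) <= p.+1)%N.
  apply: (leq_trans (size_sum _ _ _)); apply/bigmax_leqP => j _.
  by rewrite (leq_trans (size_scale_leq _ _)) // size_polyXn.
(* Grouping the multi-indices g by their value at s and their restriction to
   the other positions. *)
have coefE s (k : 'I_p.+1) : (geom_poly p.*2.+1 (x s) * P s)`_(p + k) =
    \sum_(g : {ffun 'I_p.+1 -> 'I_p.*2.+1})
      (\sum_(j < p.+1)
         (g s + k == p + j)%N%:R * Om j [ffun r => g (lift s r)])
      *: \prod_r x r ^+ g r.
  under eq_bigr => g _ do rewrite scaler_suml.
  rewrite exchange_big mulr_sumr coef_sum; apply: eq_bigr => j _ /=.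
  rewrite -scalerAr coefZ coefMXn coef_geom_poly.
  have [lt_jp lt_kp] := (ltn_ord j, ltn_ord k).
  rewrite ifF ?ifT; [|lia..].
  have lt_i : (p + j - k < p.*2.+1)%N by lia.
  rewrite (sum_ffun_lift s) (bigD1 (Ordinal lt_i)) //=.
  rewrite [X in _ + X]big1 => [|i ne_i].
    rewrite addr0 mulr_suml; apply: eq_bigr => h _.
    have -> : [ffun r => [ffun r0 => oapp h (Ordinal lt_i) (unlift s r0)]
        (lift s r)] = h.
      by apply/ffunP => r; rewrite !ffunE liftK.
    rewrite ffunE unlift_none /= (_ : (_ == _) = true); last by apply/eqP; lia.
    rewrite mul1r -scalerAl; congr (_ *: _).
    rewrite (bigD1_ord s) //= ffunE unlift_none mulrC; congr (_ * _).
      by congr (_ ^+ _) => /=; lia.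
    by apply: eq_bigr => r _; rewrite ffunE liftK.
  apply: big1 => h _; rewrite ffunE unlift_none /=.
  case: eqP => [E|_]; last by rewrite mul0r scale0r.
  by case/eqP: ne_i; apply/val_inj => /=; lia.
have mid k : (k <= p)%N ->
    (\sum_(s < p.+1) (-1) ^+ s *: (geom_poly p.*2.+1 (x s) * P s))`_(p + k) = 0.
  rewrite -ltnS => lt_kp; rewrite coef_sum.
  under eq_bigr => s _ do rewrite coefZ (coefE s (Ordinal lt_kp)) mulr_sumr.
  rewrite exchange_big big1 //= => g _.
  have := congr1 (fun a => a *: \prod_r x r ^+ g r) (Om0 g (Ordinal lt_kp)).
  rewrite scale0r scaler_suml => E0; apply: etrans E0.
  apply: eq_bigr => s _; rewrite -scalerAr [in RHS]mulrC -scalerA.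
  by rewrite -!(signr_odd _ s) scaler_sign mulr_sign.
move=> j0 h0; have := middle_coefs_inj x_inj szP mid ord0.
pose mm (j : 'I_p.+1) (h : {ffun 'I_p -> 'I_p.*2.+1}) : 'X_{1.. p.+1} :=
  [multinom (if unlift ord0 i is Some r then h r : nat else j) | i < p.+1].
have mm_inj j h : (mm j h == mm j0 h0) = (j == j0) && (h == h0).
  apply/eqP/andP => [E|[/eqP-> /eqP->] //].
  have Ei i := congr1 (fun m : 'X_{1.. p.+1} => m i) E; split; apply/eqP.
    by apply/val_inj; have := Ei ord0; rewrite !mnmE unlift_none.
  apply/ffunP => r; apply/val_inj.
  by have := Ei (lift ord0 r); rewrite !mnmE liftK.
have monE (j : 'I_p.+1) h : mon ord0 h * x ord0 ^+ j = 'X_[mm j h].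
  rewrite mpolyXE_id (bigD1_ord ord0) //= mulrC mnmE unlift_none; congr (_ * _).
  by apply: eq_bigr => r _; rewrite mnmE liftK.
move/(congr1 (fun f => f@_(mm j0 h0))); rewrite mcoeff0 => <-.
have cE j : (c ord0 j *: 'X^j).[x ord0] = \sum_h Om j h *: 'X_[mm j h].
  rewrite hornerZ hornerXn mulr_suml; apply: eq_bigr => h _.
  by rewrite -scalerAl monE.
rewrite horner_sum raddf_sum (bigD1 j0) //= [X in _ + X]big1 => [|j ne_j].
  rewrite addr0 cE raddf_sum (bigD1 h0) //= big1 => [|h ne_h].
    by rewrite mcoeffZ mcoeffX eqxx mulr1 addr0.
  by rewrite mcoeffZ mcoeffX mm_inj (negPf ne_h) andbF mulr0.
rewrite cE raddf_sum big1 //= => h _.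
by rewrite mcoeffZ mcoeffX mm_inj (negPf ne_j) mulr0.
Qed.

(** * Wedge products in coordinates *)

(** The tuples t index the basis e_(t 0) /\ ... /\ e_(t (p-1)) of
    Lambda^p K^m. *)
Notation incr_tuple p m := {t : p.-tuple 'I_m | sorted ltn (map val t)}.

Lemma card_incr_tuple (p m : nat) : #|{: incr_tuple p m}| = 'C(m, p).
Proof. by rewrite card_sig -card_ltn_sorted_tuples cardsE. Qed.

Lemma det_col_mx_mulmx (R : comNzRingType) (p q : nat) (u : 'rV[R]_(1 + p))
    (X : 'M[R]_(p, q)) (Y : 'M[R]_(q, 1 + p)) :
  \det (col_mx u (X *m Y)) =
  \sum_(h : {ffun 'I_p -> 'I_q})
     (\prod_r X r (h r)) * \det (col_mx u (rowsub h Y)).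
Proof.
under [RHS]eq_bigr => h _ do rewrite mulr_sumr.
rewrite exchange_big; apply: eq_bigr => s _ /=.
under [RHS]eq_bigr => h _ do
  rewrite mulrCA big_split_ord big_ord1 col_mxEu [X in _ * X]mulrCA.
rewrite -!mulr_sumr big_split_ord big_ord1 col_mxEu; do 2!congr (_ * _).
under [LHS]eq_bigr => r _ do rewrite col_mxEd mxE.
rewrite bigA_distr_bigA; apply: eq_bigr => h _ /=.
by rewrite -big_split; apply: eq_bigr => r _; rewrite col_mxEd mxE.
Qed.

(** The left side is alternating in h: it is 0 when h repeats an index, and
    otherwise sorting h only introduces a sign.  Stating this with coefficients
    indexed by all increasing tuples covers both cases. *)
Lemma det_rowsub_incr (R : comNzRingType) (p q : nat) (h : 'I_p -> 'I_q) :
  exists c : incr_tuple p q -> R,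
    forall (u : 'rV_(1 + p)) (Y : 'M_(q, 1 + p)),
      \det (col_mx u (rowsub h Y)) =
      \sum_t c t * \det (col_mx u (rowsub (tnth (val t)) Y)).
Proof.
have [/injectiveP h_inj | /injectivePn[r1 [r2 ne_r eq_h]]] :=
  boolP (injectiveb h); last first.
  exists (fun _ => 0) => u Y; rewrite big1 => [|t _]; last by rewrite mul0r.
  apply: (@determinant_alternate _ _ _ (rshift 1 r1) (rshift 1 r2)) => [|k].
    by rewrite (inj_eq (@rshift_inj _ _)).
  by rewrite !col_mxEd !mxE eq_h.
pose hs := [tuple h r | r < p].
pose s := sort_tuple (fun i j : 'I_q => (i <= j)%N) hs.
have incr_s : sorted ltn (map val s).
  rewrite ltn_sorted_uniq_leq map_inj_uniq ?sort_uniq; last exact: val_inj.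
  apply/andP; split.
    by apply/tuple_uniqP => r1 r2; rewrite !tnth_mktuple; apply: h_inj.
  by rewrite sorted_map sort_sorted // => i j; exact: leq_total.
have /tuple_permP[sg /val_inj hE] : perm_eq hs s by rewrite perm_sym perm_sort.
pose t0 : incr_tuple p q := Sub s incr_s.
have {}hE r : h r = tnth s (sg r).
  by have := congr1 (fun t => tnth t r) hE; rewrite !tnth_mktuple.
exists (fun t => if t == t0 then (-1) ^+ sg else 0) => u Y.
rewrite (bigD1 t0) //= eqxx [X in _ + X]big1 => [|t /negPf->]; last exact: mul0r.
rewrite addr0 -(det_perm _ sg) -[RHS]/(_ * \det (col_mx u _)).
set Z := rowsub (tnth s) Y.
have -> : rowsub h Y = perm_mx sg *m Z.
  by rewrite -row_permE; apply/matrixP => r k; rewrite !mxE hE.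
rewrite -[perm_mx sg *m Z]add0r -{1}[u]addr0 -{1}(mul1mx u) -{1}(mul0mx _ Z).
rewrite -(mul0mx _ u) -mul_block_col.
by rewrite det_mulmx det_lblock det1 mul1r.
Qed.

Lemma det_col_mx_incr (R : comNzRingType) (p q : nat) (X : 'M[R]_(p, q)) :
  exists c : incr_tuple p q -> R,
    forall (u : 'rV_(1 + p)) (Y : 'M_(q, 1 + p)),
      \det (col_mx u (X *m Y)) =
      \sum_t c t * \det (col_mx u (rowsub (tnth (val t)) Y)).
Proof.
have [c cE] := fin_all_exists (fun h : {ffun 'I_p -> 'I_q} =>
  @det_rowsub_incr R p q h).
exists (fun t => \sum_(h : {ffun 'I_p -> 'I_q}) (\prod_r X r (h r)) * c h t)
  => u Y.
rewrite det_col_mx_mulmx.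
under [RHS]eq_bigr => t _ do rewrite mulr_suml.
rewrite exchange_big; apply: eq_bigr => h _ /=.
by rewrite cE mulr_sumr; apply: eq_bigr => t _; rewrite mulrA.
Qed.

(** As an alternating function of g, the family of coordinates of
    a /\ V_0 /\ ... /\ V_(p-1) on the e_(g 0) /\ ... /\ e_(g p), where the V_r
    are the rows of V. *)
Definition wedge (R : comNzRingType) (p m : nat) (a : 'rV[R]_m)
    (V : 'M[R]_(p, m)) (g : 'I_p.+1 -> 'I_m) : R :=
  \det (colsub g (col_mx a V) : 'M_(1 + p)).

Lemma colsub_col_mx (R : Type) (m1 m2 n n' : nat) (g : 'I_n' -> 'I_n)
    (A : 'M[R]_(m1, n)) (B : 'M[R]_(m2, n)) :
  colsub g (col_mx A B) = col_mx (colsub g A) (colsub g B).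
Proof.
by apply/matrixP => i j; rewrite !mxE; case: split => k; rewrite mxE.
Qed.

(** Multiplication by a nonzero a factors through Lambda^p (K^m / a): if
    a_(i0) <> 0, subtracting multiples of a from the rows of V clears their
    coordinate i0 without changing the wedge product, which is then a
    combination of the a /\ e_t for t avoiding i0.  These t correspond to the
    increasing tuples of 'I_(m - 1) through [lift i0]. *)
Lemma wedge_factor (K : fieldType) (p m : nat) (a : 'rV[K]_m) :
  exists B : incr_tuple p m.-1 -> ('I_p.+1 -> 'I_m) -> K,
    forall V : 'M_(p, m), exists c : incr_tuple p m.-1 -> K,
      forall g, wedge a V g = \sum_t c t * B t g.
Proof.
have [-> | /rV0Pn[i0 a_i0]] := eqVneq a 0.
  exists (fun _ _ => 0) => V; exists (fun _ => 0) => g.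
  rewrite big1 => [|t _]; last exact: mul0r.
  rewrite /wedge (expand_det_row _ (lshift p ord0)) big1 // => j _.
  by rewrite mxE col_mxEu mxE mul0r.
pose E : 'M[K]_(m.-1, m) := row' i0 1%:M.
exists (fun t g =>
  \det (col_mx (colsub g a) (rowsub (tnth (val t)) (colsub g E)))).
move=> V; pose b := (a 0 i0)^-1 *: col i0 V; pose V' := V - b *m a.
have V'E : V' = col' i0 V' *m E.
  apply/matrixP => r k; rewrite [RHS]mxE.
  have [j jE|->] := unliftP i0 k.
    rewrite (bigD1 j) //= big1 => [|j' ne_j]; rewrite !mxE.
      by rewrite addr0 jE eqxx mulr1.
    by rewrite jE (inj_eq lift_inj) (negPf ne_j) mulr0.
  rewrite !mxE big_ord1 !mxE mulrAC mulVf // mul1r subrr big1 // => j _.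
  by rewrite !mxE eq_sym (negPf (neq_lift _ _)) mulr0.
have [c cE] := det_col_mx_incr (col' i0 V').
exists c => g; rewrite -cE mulmx_colsub -V'E -colsub_col_mx /wedge.
have -> : col_mx a V = block_mx 1%:M 0 b 1%:M *m col_mx a V'.
  by rewrite mul_block_col !mul1mx mul0mx addr0 addrC subrK.
by rewrite -mulmx_colsub det_mulmx det_lblock !det1 !mul1r.
Qed.

Lemma wedge_expand (R : comNzRingType) (p m : nat) (a : 'rV[R]_m)
    (V : 'M[R]_(p, m)) (g : 'I_p.+1 -> 'I_m) :
  wedge a V g =
  \sum_(s < p.+1)
     a 0 (g s) * ((-1) ^+ s * \det (colsub (fun r => g (lift s r)) V)).
Proof.
rewrite /wedge (expand_det_row _ (lshift p ord0)); apply: eq_bigr => s _.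
rewrite mxE col_mxEu /cofactor add0n; congr (_ * (_ * \det _)).
apply/matrixP => r k; rewrite !mxE.
have -> : lift (lshift p ord0) r = rshift 1 r by apply: val_inj.
by rewrite (unsplitK (inr r)).
Qed.

(** * The Koszul flattening and border rank *)

Section KoszulFlattening.
(* The coordinates of the first factor that are kept are those in the image of
   pr. *)
Variables (K : fieldType) (d m p : nat) (pr : 'I_m -> 'I_d).

Local Notation rows := (incr_tuple p m * 'I_d)%type.
Local Notation cols := ({ffun 'I_p.+1 -> 'I_m} * 'I_d)%type.

Definition basis_mx (t : incr_tuple p m) : 'M[K]_(p, m) :=
  rowsub (tnth (val t)) 1%:M.

Definition koszul_entry (T : tensor K d) (x : rows) (y : cols) : K :=
  \sum_(i < m) T (pr i, x.2, y.2) * wedge (delta_mx 0 i) (basis_mx x.1) y.1.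

(** Columns range over all maps g, not only the increasing ones: this repeats
    columns up to sign and adds zero columns, leaving the rank unchanged. *)
Definition koszul_mx (T : tensor K d) : 'M[K]_(#|{: rows}|, #|{: cols}|) :=
  \matrix_(x, y) koszul_entry T (enum_val x) (enum_val y).

Lemma rank_koszul_pure (u v w : 'rV[K]_d) :
  (\rank (koszul_mx (pure_tensor u v w)) <= 'C(m.-1, p))%N.
Proof.
rewrite -card_incr_tuple.
have [B B_spans] := @wedge_factor K p m (colsub pr u).
have [c cE] := fin_all_exists (fun t => B_spans (basis_mx t)).
pose L : 'M[K]_(#|{: rows}|, #|{: incr_tuple p m.-1}|) :=
  \matrix_(x, t) (c (enum_val x).1 (enum_val t) * v 0 (enum_val x).2).
pose N : 'M[K]_(#|{: incr_tuple p m.-1}|, #|{: cols}|) :=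
  \matrix_(t < _, y < #|{: cols}|)
    (B (enum_val t) (enum_val y).1 * w 0 (enum_val y).2).
suff -> : koszul_mx (pure_tensor u v w) = L *m N by apply: mulmx_max_rank.
apply/matrixP => x y; rewrite !mxE /koszul_entry.
transitivity (wedge (colsub pr u) (basis_mx (enum_val x).1) (enum_val y).1
    * (v 0 (enum_val x).2 * w 0 (enum_val y).2)).
  rewrite wedge_expand mulr_suml.
  under eq_bigr => i _ do rewrite ffunE wedge_expand mulr_sumr /=.
  rewrite exchange_big; apply: eq_bigr => s _ /=.
  rewrite (bigD1 ((enum_val y).1 s)) //= big1 => [|i ne_i]; rewrite !mxE eqxx.
    by rewrite eqxx /= addr0; ring.
  by rewrite eq_sym (negPf ne_i) /= mul0r mulr0.
rewrite cE mulr_suml.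
rewrite (reindex (@enum_val _ {: incr_tuple p m.-1})) /=; last first.
  by apply: onW_bij; apply: enum_val_bij.
by apply: eq_bigr => t _; rewrite !mxE; ring.
Qed.

Lemma rank_koszul (T : tensor K d) (n : nat) :
  sum_of_pure T n -> (\rank (koszul_mx T) <= n * 'C(m.-1, p))%N.
Proof.
case=> u [v [w ->]]; elim: n u v w => [|n IHn] u v w.
  rewrite big_ord0 (_ : koszul_mx 0 = 0) ?mxrank0 //.
  apply/matrixP => x y; rewrite !mxE /koszul_entry big1 // => i _.
  by rewrite ffunE mul0r.
rewrite big_ord_recr /= mulSn addnC.
set T1 := \sum_(i < n) _; set T2 := pure_tensor _ _ _.
have -> : koszul_mx (T1 + T2) = koszul_mx T1 + koszul_mx T2.
  apply/matrixP => x y; rewrite !mxE /koszul_entry -big_split /=.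
  by apply: eq_bigr => i _; rewrite ffunE mulrDl.
apply: leq_trans (mxrank_add _ _) _.
apply: leq_add; last exact: rank_koszul_pure.
exact: (IHn (fun i => u (widen_ord (leqnSn n) i))
  (fun i => v (widen_ord (leqnSn n) i)) (fun i => w (widen_ord (leqnSn n) i))).
Qed.

End KoszulFlattening.

Lemma rank_mxsub (K : fieldType) (m n m' n' : nat) (f : 'I_m' -> 'I_m)
    (g : 'I_n' -> 'I_n) (A : 'M[K]_(m, n)) :
  (\rank (mxsub f g A) <= \rank A)%N.
Proof.
rewrite -[A in mxsub _ _ A]mulmx1 mxsub_mul rowsubE.
exact: leq_trans (mxrankM_maxl _ _) (mxrankM_maxr _ _).
Qed.

Lemma exists_rank_minor (K : fieldType) (m n : nat) (A : 'M[K]_(m, n)) :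
  exists (f : 'I_(\rank A) -> 'I_m) (g : 'I_(\rank A) -> 'I_n),
    mxsub f g A \in unitmx.
Proof.
pose f := maxrankfun A.
have fullB : row_full (rowsub f A)^T.
  by have := maxrowsub_free A; rewrite /row_free /row_full mxrank_tr.
move: (fullrankfun fullB) (fullrowsub_unit fullB) => g g_unit.
exists f, g; rewrite -unitmx_tr (_ : _^T = rowsub g (rowsub f A)^T) //.
by apply/matrixP => i j; rewrite !mxE.
Qed.

(** A nonzero minor of maximal size of [koszul_mx T] is a polynomial in the
    entries of the tensor.  If n * 'C(m - 1, p) were smaller than that size, it
    would vanish on tensors of rank at most n, hence on the Zariski closure. *)
Lemma rank_koszul_border (K : fieldType) (d m p : nat) (pr : 'I_m -> 'I_d)
    (T : tensor K d) :
  (\rank (koszul_mx p pr T) <= border_rank T * 'C(m.-1, p))%N.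
Proof.
rewrite /border_rank; case: ex_minnP => n /asboolP T_closure _.
rewrite leqNgt; apply/negP => rank_gt.
have [f [g]] := exists_rank_minor (koszul_mx p pr T).
set r := \rank _ in rank_gt f g *; rewrite unitmxE unitfE => /negP; apply.
pose F : {mpoly K[#|{: 'I_d * 'I_d * 'I_d}|]} := \det (\matrix_(x < r, y < r)
  \sum_(i < m) 'X_(enum_rank (pr i, (enum_val (f x)).2, (enum_val (g y)).2))
    * (wedge (delta_mx 0 i) (basis_mx K (enum_val (f x)).1)
         (enum_val (g y)).1)%:MP).
have F_eval T' : eval_at F T' = \det (mxsub f g (koszul_mx p pr T')).
  rewrite /eval_at /F -det_map_mx; congr (\det _); apply/matrixP => x y.
  rewrite !mxE rmorph_sum; apply: eq_bigr => i _ /=.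
  by rewrite mevalM mevalC mevalXU enum_rankK.
rewrite -F_eval; apply/eqP; apply: T_closure => T'.
rewrite /rank_le /tensor_rank F_eval.
case: ex_minnP => k /asboolP pureT' _ le_kn.
apply/eqP; rewrite -[_ == 0]negbK -unitfE -unitmxE -row_free_unit -row_leq_rank.
rewrite -ltnNge; apply: leq_ltn_trans (rank_mxsub _ _ _) _.
apply: leq_ltn_trans (rank_koszul p pr pureT') _.
by apply: leq_ltn_trans rank_gt; rewrite leq_mul2r le_kn orbT.
Qed.

(** * The tensor built from shift matrices *)

Lemma minor_basis_mx (K : fieldType) (m p : nat) (t t0 : incr_tuple p m) :
  \det (colsub (tnth (val t0)) (basis_mx K t)) = (t == t0)%:R.
Proof.
have uniq_incr (t1 : incr_tuple p m) : uniq (val t1).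
  by have := valP t1; rewrite ltn_sorted_uniq_leq => /andP[/map_uniq].
have [->|ne_t] := eqVneq.
  rewrite (_ : colsub _ _ = 1%:M) ?det1 //; apply/matrixP => r k; rewrite !mxE.
  by rewrite (inj_eq (tuple_uniqP _ (uniq_incr t0))).
have [r r_notin] : exists r, tnth (val t) r \notin val t0.
  apply/existsP; rewrite -negb_forall; apply: contra ne_t => /forallP t_sub.
  have sub : {subset val t <= val t0}.
    by move=> i /tnthP[r ->]; apply: t_sub.
  have sz : (size (val t0) <= size (val t))%N by rewrite !size_tuple.
  have [_ eq_tt0] := uniq_min_size (uniq_incr t) sub sz.
  apply/eqP/val_inj/val_inj/(inj_map val_inj).
  apply: (irr_sorted_eq ltn_trans ltnn (valP t) (valP t0)).
  exact: eq_mem_map.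
rewrite (expand_det_row _ r) big1 // => k _; rewrite !mxE.
case: eqP => [E|_]; last by rewrite mul0r.
by rewrite E mem_tnth in r_notin.
Qed.

(** A left kernel vector z splits according to the two diagonal blocks.  Within
    a block, entry (j, k) of the shift matrix of index i + 1 is 1 exactly when
    i + k = p + j, which is the condition of [koszul_middle_inj] for
    Om j h = sum_t z (t, j) e_t (h).  Evaluating Om j at an increasing tuple
    recovers the coordinate of z there. *)
Lemma row_free_koszul_shift (K : fieldType) (p : nat)
    (pr : 'I_p.*2.+1 -> 'I_(p.+1 + p.+1)) (T : tensor K (p.+1 + p.+1)) :
  (forall i b c, T (pr i, b, c) =
     block_mx (shift_mx K p i.+1) 0 0 (shift_mx K p i.+1) b c) ->
  row_free (koszul_mx p pr T).
Proof.
move=> TE; apply: inj_row_free => y yM0.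
pose z t b := y 0 (enum_rank (t, b)).
have eqn (g : {ffun 'I_p.+1 -> 'I_p.*2.+1}) c :
    \sum_t \sum_b z t b * koszul_entry pr T (t, b) (g, c) = 0.
  have := congr1 (fun v : 'rV_ _ => v 0 (enum_rank (g, c))) yM0.
  rewrite !mxE (reindex (@enum_rank _)) /=; last first.
    by apply: onW_bij; apply: enum_rank_bij.
  move=> y0; rewrite pair_bigA /= -[RHS]y0; apply: eq_bigr => -[t b] _.
  by rewrite mxE !enum_rankK.
have wE t (g : {ffun 'I_p.+1 -> 'I_p.*2.+1}) (k j : 'I_p.+1) :
    \sum_(i < p.*2.+1)
       (i + k == p + j)%N%:R * wedge (delta_mx 0 i) (basis_mx K t) g =
    \sum_(s < p.+1) (g s + k == p + j)%N%:R *
       ((-1) ^+ s * \det (colsub [ffun r => g (lift s r)] (basis_mx K t))).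
  under eq_bigr => i _ do rewrite wedge_expand mulr_sumr.
  rewrite exchange_big; apply: eq_bigr => s _ /=.
  rewrite (bigD1 (g s)) //= big1 => [|i ne_i]; rewrite !mxE eqxx.
    rewrite eqxx /= addr0 mul1r; congr (_ * (_ * \det _)).
    by apply/matrixP => r l; rewrite !mxE ffunE.
  by rewrite [g s == i]eq_sym (negPf ne_i) /= mul0r mulr0.
have block_eq0 (emb : 'I_p.+1 -> 'I_(p.+1 + p.+1)) :
    (forall t g k, \sum_b z t b * koszul_entry pr T (t, b) (g, emb k) =
       \sum_(j < p.+1) z t (emb j) *
         \sum_(i < p.*2.+1) (i + k == p + j)%N%:R
           * wedge (delta_mx 0 i) (basis_mx K t) g) ->
    forall t j, z t (emb j) = 0.
  move=> entryE t0 j0.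
  pose Om j (h : {ffun 'I_p -> 'I_p.*2.+1}) :=
    \sum_t z t (emb j) * \det (colsub h (basis_mx K t)).
  have Om0 : Om j0 [ffun r => tnth (val t0) r] = 0.
    apply: koszul_middle_inj => g k; rewrite -[RHS](eqn g (emb k)).
    under eq_bigr => s _ do rewrite mulr_sumr.
    under [RHS]eq_bigr => t _ do rewrite entryE.
    rewrite exchange_big [RHS]exchange_big; apply: eq_bigr => j _ /=.
    under eq_bigr => s _ do rewrite mulrA mulr_sumr.
    rewrite exchange_big; apply: eq_bigr => t _ /=.
    by rewrite wE mulr_sumr; apply: eq_bigr => s _; ring.
  have minorE t :
      \det (colsub [ffun r => tnth (val t0) r] (basis_mx K t)) = (t == t0)%:R.
    rewrite -minor_basis_mx; congr (\det _).
    by apply/matrixP => r l; rewrite !mxE ffunE.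
  rewrite -Om0 /Om (bigD1 t0) //= big1 => [|t ne_t].
    by rewrite minorE eqxx mulr1 addr0.
  by rewrite minorE (negPf ne_t) mulr0.
have shiftE (i : 'I_p.*2.+1) (j k : 'I_p.+1) :
    shift_mx K p i.+1 j k = (i + k == p + j)%N%:R.
  by rewrite mxE; congr (nat_of_bool _)%:R; apply/eqP/eqP; lia.
have blockE (j k : 'I_p.+1) (t : incr_tuple p p.*2.+1) g :
    koszul_entry pr T (t, lshift _ j) (g, lshift _ k) =
      \sum_(i < p.*2.+1) (i + k == p + j)%N%:R
        * wedge (delta_mx 0 i) (basis_mx K t) g
  /\ koszul_entry pr T (t, rshift _ j) (g, rshift _ k) =
      \sum_(i < p.*2.+1) (i + k == p + j)%N%:R
        * wedge (delta_mx 0 i) (basis_mx K t) g.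
  by split; apply: eq_bigr => i _; rewrite TE ?block_mxEul ?block_mxEdr shiftE.
have blockE0 (j k : 'I_p.+1) (t : incr_tuple p p.*2.+1) g :
    koszul_entry pr T (t, lshift _ j) (g, rshift _ k) = 0
  /\ koszul_entry pr T (t, rshift _ j) (g, lshift _ k) = 0.
  by split; apply: big1 => i _; rewrite TE ?block_mxEur ?block_mxEdl mxE mul0r.
suff z0 t b : z t b = 0.
  apply/rowP => x; rewrite mxE -[x]enum_valK; case: (enum_val x) => t b.
  exact: z0.
have [j ->|j ->] := split_ordP b; apply: block_eq0 => {}t g k;
  rewrite big_split_ord /=.
  rewrite [X in _ + X]big1 ?addr0 => [|j' _].
    by apply: eq_bigr => j' _; rewrite (blockE _ _ _ _).1.
  by rewrite (blockE0 _ _ _ _).2 mulr0.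
rewrite [X in X + _]big1 ?add0r => [|j' _].
  by apply: eq_bigr => j' _; rewrite (blockE _ _ _ _).2.
by rewrite (blockE0 _ _ _ _).1 mulr0.
Qed.

Theorem mainTheorem9 (K : fieldType) (d m p : nat)
    (d_ge2 : (2 <= d)%N) (d_even : ~~ odd d)
    (mE : m = d.-1) (mEp : m = p.*2.+1) :
  (2 * d - 2 <=
   border_rank
     (\sum_(i < d | (i < m)%N)
        tens_vec_mx (delta_mx 0 i)
          (shift_mx_dsum K i.+1 (double_dim d_ge2 mE mEp)))%R)%N.
Proof.
move: (double_dim d_ge2 mE mEp) => dE; subst m d.
set T := (\sum_(i < _ | _) _)%R.
have le_md : (p.*2.+1 <= p.+1 + p.+1)%N by lia.
pose pr := widen_ord le_md.
have TE (i : 'I_p.*2.+1) b c : T (pr i, b, c) =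
    block_mx (shift_mx K p i.+1) 0 0 (shift_mx K p i.+1) b c.
  rewrite sum_ffunE (bigD1 (pr i)) /=; last by have := ltn_ord i; lia.
  rewrite big1 => [|i' /andP[_ ne_i']].
    rewrite ffunE /= /shift_mx_dsum castmx_id [delta_mx _ _ _ _]mxE.
    by rewrite !eqxx mul1r addr0.
  by rewrite ffunE !mxE (eq_sym (pr i)) (negPf ne_i') mul0r.
have := rank_koszul_border p pr T.
rewrite (eqP (row_free_koszul_shift TE)) card_prod card_incr_tuple card_ord.
have := mul_bin_down p.*2.+1 p; rewrite (_ : p.*2.+1 - p = p.+1)%N; last by lia.
have : (0 < 'C(p.*2, p))%N by rewrite bin_gt0; lia.
rewrite succnK => C_gt0 binE le_rank.
rewrite -(leq_pmul2r C_gt0); apply: leq_trans le_rank.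
by rewrite (_ : 2 * _ - 2 = 2 * p.*2.+1)%N; [rewrite -mulnA binE; nia | lia].
Qed.
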